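(* Let $k\le n$ be positive integers. Then every smooth $k$-gon with $n$ boundary points has (normalized) area bounded above by $\phi^{2k}n^2$, where $\phi=\frac{1+\sqrt5}{2}=1.618\dots$ is the golden ratio.
   Context: A lattice polygon is a two-dimensional convex hull of finitely many points of a lattice $M\cong\mathbb{Z}^2$ in $M\otimes\mathbb{R}$. It is smooth if at every vertex the primitive generators of its normal cone (equivalently, the primitive edge directions at the vertex) form a lattice basis. A smooth $k$-gon with $n$ boundary points is a smooth lattice polygon with exactly $k$ vertices and exactly $n$ lattice points on its boundary. The normalized area is the area measure that assigns $1$ to the triangle $\mathrm{conv}(0,e_1,e_2)$ for any basis $e_1,e_2$ of $M$ (i.e. twice the Euclidean area when $M=\mathbb{Z}^2$). *)

(* Defs.v *)
From HB Require Import structures.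
From mathcomp Require Import all_boot all_order all_algebra.
From mathcomp Require Import all_classical all_reals all_analysis.
Set Implicit Arguments.
Unset Strict Implicit.
Unset Printing Implicit Defensive.
Import Order.TTheory GRing.Theory Num.Theory.
Import numFieldNormedType.Exports.
Local Open Scope classical_set_scope.
Local Open Scope card_scope.
Local Open Scope ring_scope.

(* A choice of basis identifies the lattice M with Z^2, here int * int, and its
   extension of scalars to the reals with R * R. *)
Definition lattice := (int * int)%type.

Definition lattice_basis (d e : lattice) : Prop :=
  forall m : lattice, exists! ab : int * int, m = d *~ ab.1 + e *~ ab.2.

(* The zero vector is not primitive, being 2 times itself. *)
Definition primitive (d : lattice) : Prop :=
  forall (e : lattice) (a : int), d = e *~ a -> a = 1 \/ a = -1.

Section Polygons.
Variable R : realType.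
Implicit Types (P : set (R * R)) (u x y z v : R * R).

Definition lattice_point (m : lattice) : R * R := (m.1%:~R, m.2%:~R).

Definition conv_hull (N : nat) (p : 'I_N -> R * R) : set (R * R) :=
  [set x | exists w : 'I_N -> R,
     [/\ forall i, 0 <= w i, \sum_i w i = 1 & x = \sum_i w i *: p i]].

Definition noncollinear x y z : Prop :=
  (y.1 - x.1) * (z.2 - x.2) - (y.2 - x.2) * (z.1 - x.1) != 0.

Definition two_dimensional P : Prop :=
  exists x y z, [/\ P x, P y, P z & noncollinear x y z].

Definition lattice_polygon P : Prop :=
  two_dimensional P /\
  exists (N : nat) (p : 'I_N -> lattice), P = conv_hull (lattice_point \o p).

Definition pairing u x : R := u.1 * x.1 + u.2 * x.2.

Definition face P u : set (R * R) :=
  [set x | P x /\ forall y, P y -> pairing u y <= pairing u x].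

Definition vertices P : set (R * R) := [set v | exists u, face P u = [set v]].

(* d is the primitive direction, pointing away from v, of an edge of P through
   v: for two-dimensional P, the edges are the faces with u != 0 that contain
   more than one point. *)
Definition primitive_edge_direction P v (d : lattice) : Prop :=
  primitive d /\
  exists u, [/\ u != 0, face P u v &
    exists2 t : R, 0 < t & face P u (v + t *: lattice_point d)].

Definition smooth P : Prop :=
  forall v, vertices P v -> exists d e : lattice,
    primitive_edge_direction P v = [set d; e] /\ lattice_basis d e.

Definition boundary P : set (R * R) := closure P `\` P°.

Definition smooth_kgon (k n : nat) P : Prop :=
  [/\ lattice_polygon P, smooth P, vertices P #= `I_k &
      [set m : lattice | boundary P (lattice_point m)] #= `I_n].

Definition normalized_area P : \bar R :=
  (2%:E * (lebesgue_measure \x lebesgue_measure) P)%E.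

Definition golden_ratio : R := (1 + Num.sqrt 5) / 2.

End Polygons.

(* Main.v *)
(* For consecutive edge directions d_i, d_(i+1), written counterclockwise, smoothness
   says det (d_i, d_(i+1)) = 1, and convexity says that no edge direction lies in the
   open cone they span. If some direction d_i has its opposite among the directions,
   then the values det (d_i, d_j) on a half plane form a sequence 0, 1, .., 1, 0 in
   which each term divides the sum of its neighbours; a maximal term >= 2 is the sum of
   its neighbours, and deleting it leaves a shorter such sequence, so these values are
   bounded by Fibonacci numbers. Some i gives coordinates (x, y) in the basis
   (d_i, d_(i+1)) such that x <= phi^(k-1) and y <= phi^(k-1) on all edge directions: each
   of these coordinates is either bounded in this way or at most 1. The total lattice
   length of the edges is at most n, so both widths of P in this basis are at most
   phi^(k-1) n, and P lies in a unimodular parallelogram of normalized area at most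
   2 phi^(2k-2) n^2 <= phi^(2k) n^2. *)
From HB Require Import structures.
Require Import Defs.
From mathcomp Require Import all_boot all_order all_algebra.
From mathcomp Require Import all_classical all_reals all_analysis.
From mathcomp Require Import measurable_realfun.
From mathcomp Require Import ring lra zify.
Set Implicit Arguments.
Unset Strict Implicit.
Unset Printing Implicit Defensive.
Import Order.TTheory GRing.Theory Num.Theory.
Import numFieldNormedType.Exports.
Local Open Scope classical_set_scope.
Local Open Scope card_scope.
Local Open Scope ring_scope.

(** * Planar Lebesgue measure *)

Section Measure.
Variable R : realType.
Local Notation mu := (@lebesgue_measure R).
Local Notation mu2 := ((@lebesgue_measure R) \x (@lebesgue_measure R))%E.

Lemma lebesgue_measure_translate (c : R) (A : set R) : measurable A ->
  mu ((fun x => x + c) @^-1` A) = mu A.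
Proof.
move=> mA.
have mf : measurable_fun setT ((fun x => x + c) : measurableTypeR R -> measurableTypeR R).
  exact: measurable_funD.
pose mfp : {mfun _ >-> _} :=
  HB.pack ((fun x => x + c) : measurableTypeR R -> measurableTypeR R)
    (isMeasurableFun.Build _ _ _ _ _ mf).
suff: mu A = pushforward mu mfp A by move=> ->.
apply: lebesgue_measure_unique => //= _ [[a b]] _ <-.
rewrite /pushforward.
have -> : mfp @^-1` `]a, b] = `]a - c, b - c]%classic.
  by apply/seteqP; split => x /=; rewrite !in_itv /= ltrBlDr lerBrDr.
rewrite !lebesgue_measure_itv/= !lte_fin ltrD2r -!EFinB.
by congr (if _ then _%:E else _); ring.
Qed.

(** The measure is an outer-measure extension, and these are monotone on all sets. The area of [P]
    can thus be compared with that of a parallelogram directly. *)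
Lemma le_lebesgue_measure (A B : set R) : A `<=` B -> (mu A <= mu B)%E.
Proof.
move=> AB; rewrite /lebesgue_measure /lebesgue_stieltjes_measure /measure_extension.
exact: (le_mu_ext (wlength idfun) AB).
Qed.

(** The integral of a nonnegative function is a supremum over simple functions below it, so
    comparing the measures of sections pointwise is enough. *)
Lemma le_lebesgue_measure2 (A B : set (R * R)) : A `<=` B -> (mu2 A <= mu2 B)%E.
Proof.
move=> AB; rewrite /product_measure1 !ge0_integralE//.
apply: le_ereal_sup => _ [h hA <-]; exists h => // x.
apply: (le_trans (hA x)); rewrite !patchE; case: ifP => // _ /=.
apply: le_lebesgue_measure => y; rewrite /xsection /= !inE; exact: AB.
Qed.

Lemma lebesgue_measure2_shearr (c : R) (A : set (R * R)) : measurable A ->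
  mu2 ((fun z => (z.1, z.2 + c * z.1)) @^-1` A) = mu2 A.
Proof.
move=> mA; apply: eq_integral => x _ /=.
rewrite -[RHS](lebesgue_measure_translate (c * x)); last exact: measurable_xsection.
by congr (mu _); apply/seteqP; split => y /=; rewrite /xsection /= !inE.
Qed.

Lemma lebesgue_measure2_shearl (c : R) (A : set (R * R)) : measurable A ->
  measurable ((fun z => (z.1 + c * z.2, z.2)) @^-1` A) ->
  mu2 ((fun z => (z.1 + c * z.2, z.2)) @^-1` A) = mu2 A.
Proof.
(* By uniqueness of the product measure both orders of integration agree, which allows slicing along
   the second coordinate. *)
have E X : measurable X -> mu2 X = (mu \x^ mu)%E X.
  by move=> mX; apply: product_measure_unique => //= *; rewrite product_measure2E.
move=> mA mA'; rewrite !E//; apply: eq_integral => x _ /=.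
rewrite -[RHS](lebesgue_measure_translate (c * x)); last exact: measurable_ysection.
by congr (mu _); apply/seteqP; split => y /=; rewrite /ysection /= !inE.
Qed.

Lemma measurable_linear2 (p q : R) :
  measurable_fun [set: R * R] (fun z => p * z.1 + q * z.2).
Proof.
by apply: measurable_funD; apply: measurable_funM => //; exact: measurable_cst.
Qed.

Lemma measurable_preimage_linear2 (p q r s : R) (A : set (R * R)) :
  measurable A ->
  measurable ((fun z => (p * z.1 + q * z.2, r * z.1 + s * z.2)) @^-1` A).
Proof.
move=> mA; rewrite -[_ @^-1` _]setTI.
have mf : measurable_fun [set: R * R]
    (fun z => (p * z.1 + q * z.2, r * z.1 + s * z.2)).
  by apply/measurable_fun_pair; exact: measurable_linear2.
exact: mf.
Qed.

(** For [r != 0] the matrix is a product of three shears, with parameters [(p - 1) / r], [r],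
    [(s - 1) / r]. For [r = 0], composing with one more shear replaces the lower left entry by [s],
    which is nonzero. *)
Lemma lebesgue_measure2_unimodular (p q r s : R) (A : set (R * R)) :
  p * s - q * r = 1 -> measurable A ->
  mu2 ((fun z => (p * z.1 + q * z.2, r * z.1 + s * z.2)) @^-1` A) = mu2 A.
Proof.
have shearl c B : measurable B ->
    measurable ((fun z : R * R => (z.1 + c * z.2, z.2)) @^-1` B).
  move=> /(measurable_preimage_linear2 1 c 0 1); congr measurable.
  by apply/seteqP; split => z /=; rewrite !mul1r mul0r add0r.
have shearr c B : measurable B ->
    measurable ((fun z : R * R => (z.1, z.2 + c * z.1)) @^-1` B).
  move=> /(measurable_preimage_linear2 1 0 c 1); congr measurable.
  by apply/seteqP; split => z /=; rewrite !mul1r mul0r addr0 addrC.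
have main p' q' r' s' : p' * s' - q' * r' = 1 -> r' != 0 -> measurable A ->
    mu2 ((fun z => (p' * z.1 + q' * z.2, r' * z.1 + s' * z.2)) @^-1` A) = mu2 A.
  move=> det1 r0 mA.
  rewrite -[RHS](lebesgue_measure2_shearl (c := (p' - 1) / r'))//; last exact: shearl.
  rewrite -[RHS](lebesgue_measure2_shearr r'); last exact: shearl.
  rewrite -[RHS](lebesgue_measure2_shearl (c := (s' - 1) / r'))//;
    [|exact: (shearr _ _ (shearl _ _ mA))|exact: (shearl _ _ (shearr _ _ (shearl _ _ mA)))].
  congr (mu2 _); apply/seteqP; split => z /=; congr (A (_, _)); try by field.
    - have -> : q' = (p' * s' - 1) / r' by rewrite -det1; field.
      by field.
    - have -> : q' = (p' * s' - 1) / r' by rewrite -det1; field.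
      by field.
move=> det1 mA; have [r0|] := eqVneq r 0; last by move=> r0; exact: main.
rewrite -(lebesgue_measure2_shearr 1); last exact: measurable_preimage_linear2.
rewrite -[RHS](main (p + q) q s s); last 3 first.
- by rewrite -det1 r0; ring.
- by apply: contra_eq_neq det1 => ->; rewrite r0 !mulr0 subr0 eq_sym oner_eq0.
- exact: mA.
by congr (mu2 _); apply/seteqP; split => z /=; congr (A (_, _)); rewrite ?r0; ring.
Qed.

Lemma area_parallelogram_le (p q r s x0 y0 W : R) (P : set (R * R)) :
  p * s - q * r = 1 -> 0 <= W ->
  (forall z, P z -> x0 <= p * z.1 + q * z.2 <= x0 + W) ->
  (forall z, P z -> y0 <= r * z.1 + s * z.2 <= y0 + W) ->
  (mu2 P <= (W ^+ 2)%:E)%E.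
Proof.
move=> det1 W0 Px Py.
pose B : set (R * R) := `[x0, x0 + W]%classic `*` `[y0, y0 + W]%classic.
have mB : measurable B by exact: measurableX.
apply: (@le_trans _ _ (mu2 B)).
  rewrite -(lebesgue_measure2_unimodular det1 mB); apply: le_lebesgue_measure2.
  by move=> z Pz; split => /=; rewrite in_itv /=; [exact: Px|exact: Py].
rewrite /B product_measure1E//= !lebesgue_measure_itv /= !lte_fin !ltrDl.
case: ifP => W1; last by rewrite mule0 lee_fin sqr_ge0.
by rewrite -!EFinB -EFinM lee_fin !(addrC _ W) !addrK expr2.
Qed.

End Measure.

(** * Fibonacci growth *)

(** The second inequality strengthens the induction on [r]: a deleted term is the sum of its
    neighbours, which become consecutive in the shorter sequence. *)
Lemma fibonacci_bound (R : realFieldType) (phi : R) (r : nat) (y : nat -> int) :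
  1 <= phi -> phi ^+ 2 = phi + 1 ->
  y 0%N = 0 -> y 1%N = 1 -> y r = 0 ->
  (forall t, (0 < t < r)%N -> 0 < y t) ->
  (forall t, (t.+2 <= r)%N -> exists a, y t + y t.+2 = a * y t.+1) ->
  forall t, (t < r)%N ->
    (y t)%:~R * phi <= phi ^+ r /\ (y t + y t.+1)%:~R <= phi ^+ r.
Proof.
move=> phi1 phi2; elim: r y => [//|r IHr] y y0 y1 yr ypos yrec.
have r1 : (1 <= r)%N by case: r yr {IHr ypos yrec} => //; rewrite y1.
have [[i ir yi]|small] := pselect (exists2 i, (i <= r)%N & 1 < y i); last first.
  have phir : phi ^+ 2 <= phi ^+ r.+1 by apply: ler_weXn2l => //; lia.
  have le1 i : (i <= r.+1)%N -> y i <= 1.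
    rewrite leq_eqVlt => /orP[/eqP->|ir]; first by rewrite yr.
    by rewrite leNgt; apply/negP => yi; apply: small; exists i.
  move=> t tr; have yt : y t <= 1 by apply: le1; lia.
  have yt1 : y t.+1 <= 1 by apply: le1.
  have ytR : (y t)%:~R <= 1 :> R by rewrite -[1]/(1%:~R) ler_int.
  have yttR : (y t + y t.+1)%:~R <= 2 :> R by rewrite -[2]/(2%:~R) ler_int; lia.
  split; last by lra.
  by nra.
(* [M] is the first position of the maximum, so the inequality to its left is strict. *)
have [M [Mr yM1 yM Mfirst]] : exists M, [/\ (M <= r)%N, 1 < y M,
   forall j, (j <= r.+1)%N -> y j <= y M & forall j, (j < M)%N -> y j < y M].
  pose f (i : 'I_r.+2) := y i.
  have [k0 _ kmax] := @Order.TotalTheory.arg_maxP _ _ 'I_r.+2 (inord i) xpredT f isT.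
  have ex : exists j, (j <= r.+1)%N && (y j == y k0).
    by exists k0; rewrite eqxx andbT -ltnS.
  have [M /andP[Mr /eqP My] Mmin] := ex_minnP ex.
  have max j : (j <= r.+1)%N -> y j <= y M.
    by rewrite -ltnS => jr; rewrite My; have := kmax (Ordinal jr) isT.
  have M1 : 1 < y M by apply: lt_le_trans yi _; apply: max; lia.
  have MNr : M != r.+1 by apply: contraTneq M1 => ->; rewrite yr.
  exists M; split => //; first by lia.
  move=> j jM; rewrite lt_neqAle max ?andbT; last by lia.
  apply/eqP => yjM; have : (M <= j)%N by apply: Mmin; rewrite yjM My eqxx andbT; lia.
  by lia.
have {i ir yi} [i iE] : exists j, M = j.+2.
  by case: M yM1 {Mr yM Mfirst} => [|[|j]]; rewrite ?y0 ?y1//; exists j.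
subst M.
have [a ya] := yrec i.+1 ltac:(lia).
(* The sum of the neighbours is positive and less than twice the maximum, so the multiplier is 1. *)
have sumE : y i.+1 + y i.+3 = y i.+2.
  have p1 : 0 < y i.+1 by apply: ypos; lia.
  have p3 : 0 <= y i.+3.
    have [->|ne] := eqVneq i.+3 r.+1; first by rewrite yr.
    by apply/ltW/ypos; lia.
  have lt1 := Mfirst i.+1 (ltnSn _).
  have le3 := yM i.+3 ltac:(lia).
  have a0 : 0 < a by nia.
  have a2 : a < 2 by nia.
  have a1 : a = 1 by lia.
  by rewrite ya a1 mul1r.
pose z t := if (t <= i.+1)%N then y t else y t.+1.
have zl t : (t <= i.+1)%N -> z t = y t by rewrite /z => ->.
have zg t : (i.+1 < t)%N -> z t = y t.+1 by rewrite /z ltnNge => /negbTE ->.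
(* Deleting a term equal to the sum of its neighbours lowers the multipliers at these neighbours by
   one and keeps the others. *)
have zrec t : (t.+2 <= r)%N -> exists a, z t + z t.+2 = a * z t.+1.
  move=> tr.
  have [ti|it] := leqP t.+2 i.+1.
    by rewrite !zl; [apply: yrec; lia|lia|lia|lia].
  have [->|nti] := eqVneq t i.
    rewrite (zl i)// (zl i.+1)// (zg i.+2)//.
    have [b yb] := yrec i ltac:(lia).
    by exists (b - 1); rewrite mulrBl -yb -sumE; ring.
  have [->|nti1] := eqVneq t i.+1.
    rewrite (zl i.+1)// !zg//.
    have [b yb] := yrec i.+2 ltac:(lia).
    by exists (b - 1); rewrite mulrBl -yb -sumE; ring.
  by rewrite !zg; [apply: yrec; lia|lia|lia|lia].
have IH := IHr z.
have {}IH t : (t < r)%N -> (z t)%:~R * phi <= phi ^+ r /\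
    (z t + z t.+1)%:~R <= phi ^+ r.
  apply: IH => //; first by rewrite zg.
  by move=> s /andP[s0 sr]; rewrite /z; case: ifP => _; apply: ypos; lia.
have phirS : phi ^+ r.+1 = phi * phi ^+ r by rewrite exprS.
set A := phi ^+ r in IH phirS *.
have A0 : 0 <= A by apply: exprn_ge0; lra.
have bound1 j : (j <= r)%N -> j != i.+2 -> (y j)%:~R * phi <= A.
  move=> jr ji; have [jl|jg] := leqP j i.+1.
    by have [] := IH j ltac:(lia); rewrite zl.
  by have [] := IH j.-1 ltac:(lia); rewrite zg ?prednK//; lia.
have bound2 : (y i.+2)%:~R <= A.
  have [_] := IH i.+1 ltac:(lia); by rewrite zl// zg// sumE.
(* Since [phi - 1] is the inverse of [phi], this is [bound1] divided by [phi]. Together with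
   [bound2] it bounds sums that involve the deleted term by [A + A * (phi - 1) = A * phi]. *)
have bound3 j : (j <= r.+1)%N -> j != i.+2 -> (y j)%:~R <= A * (phi - 1).
  move=> jr ji; have [->|jNr] := eqVneq j r.+1.
    by rewrite yr mulr_ge0// subr_ge0.
  have := bound1 j ltac:(lia) ji.
  set b := (y j)%:~R => bA.
  have -> : b = b * phi * (phi - 1) by rewrite -mulrA mulrBr mulr1 -expr2 phi2; ring.
  by apply: ler_wpM2r => //; lra.
rewrite phirS => t tr.
have [->|nti] := eqVneq t i.+2.
  split; first by rewrite mulrC; apply: ler_wpM2l => //; lra.
  have := bound3 i.+3 ltac:(lia) ltac:(lia); rewrite intrD.
  by set b := (y i.+3)%:~R; set c := (y i.+2)%:~R in bound2 *; lra.
have b1 := bound1 t ltac:(lia) nti.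
split; first by nra.
have b3 := bound3 t ltac:(lia) nti.
have [E|nti1] := eqVneq t.+1 i.+2.
  rewrite E intrD; set b := (y t)%:~R in b3 *; set c := (y i.+2)%:~R in bound2 *; lra.
have [tl|tg] := leqP t.+1 i.+1.
  have [_] := IH t ltac:(lia); rewrite !zl//; last by lia.
  by set b := (_ + _)%:~R; nra.
have [_] := IH t.-1 ltac:(lia); rewrite !zg ?prednK; try lia.
by set b := (_ + _)%:~R; nra.
Qed.

(** * Fans of edge directions *)

Definition latdet (d e : lattice) : int := d.1 * e.2 - d.2 * e.1.

Lemma latdet_plucker (a b c e : lattice) :
  latdet a b * latdet c e - latdet a c * latdet b e + latdet a e * latdet b c = 0.
Proof. rewrite /latdet; ring. Qed.

Lemma latdetC (d e : lattice) : latdet e d = - latdet d e.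
Proof. rewrite /latdet; ring. Qed.

Lemma latdetNr (d e : lattice) : latdet d (- e) = - latdet d e.
Proof. rewrite /latdet /=; ring. Qed.

Lemma latdetNl (d e : lattice) : latdet (- d) e = - latdet d e.
Proof. rewrite /latdet /=; ring. Qed.

Lemma latdetDr (d e f : lattice) : latdet d (e + f) = latdet d e + latdet d f.
Proof. rewrite /latdet /=; ring. Qed.

Lemma latdetBr (d e f : lattice) : latdet d (e - f) = latdet d e - latdet d f.
Proof. rewrite /latdet /=; ring. Qed.

Lemma latdetMn (d e : lattice) n : latdet d (e *+ n) = latdet d e *+ n.
Proof. by elim: n => [|n IH]; rewrite ?mulr0n ?mulrS ?latdetDr ?IH// /latdet /= !mulr0 subr0. Qed.

Lemma latdetvv (d : lattice) : latdet d d = 0.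
Proof. rewrite /latdet; ring. Qed.

Lemma lattice_mulrz (u : lattice) (a : int) : u *~ a = (u.1 * a, u.2 * a).
Proof. by rewrite [LHS]surjective_pairing (raddfMz fst) (raddfMz snd) !mulrzz. Qed.

Lemma lattice_coordE (d e v : lattice) : latdet d e = 1 ->
  v = d *~ latdet v e + e *~ latdet d v.
Proof.
move=> de; rewrite !lattice_mulrz; case: d e v de => [d1 d2] [e1 e2] [v1 v2].
rewrite /latdet /= => de; congr pair.
  by rewrite -[LHS]mulr1 -de /=; ring.
by rewrite -[LHS]mulr1 -de /=; ring.
Qed.

(* The directions are listed counterclockwise, with indices modulo K. *)
Record edge_fan (K : nat) (d : nat -> lattice) : Prop := EdgeFan {
  fan_pos : (0 < K)%N;
  fan_periodic : forall i, d (i + K)%N = d i;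
  fan_basis : forall i, latdet (d i) (d i.+1) = 1;
  fan_empty : forall i j,
    0 < latdet (d i) (d j) -> 0 < latdet (d j) (d i.+1) -> False;
  fan_complete : forall i w,
    0 < latdet (d i) w -> exists j, latdet (d j) w < 0 }.

Lemma pos_mulz_eq1 (x y : int) : 0 < x -> x * y = 1 -> x = 1.
Proof.
move=> x0 xy; have y0 : 0 < y by rewrite -(pmulr_rgt0 _ x0) xy.
have : x <= x * y by apply: ler_peMr; lia.
by lia.
Qed.

Section Fan.
Variables (K : nat) (d : nat -> lattice).
Hypothesis fan : edge_fan K d.
Local Notation D i j := (latdet (d i) (d j)).

Lemma fan_periodicM i q : d (i + q * K)%N = d i.
Proof.
elim: q => [|q IH]; first by rewrite mul0n addn0.
by rewrite mulSn (addnC K) addnA (fan_periodic fan).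
Qed.

(** In the basis [d i], [d i.+1] the vector [d p] has coordinates [x = D p i.+1] and [y = D i p].
    Below, names starting with x and y refer to these, and quadrants are taken in this basis. *)
Lemma fan_coord i p q : D p q = D p i.+1 * D i q - D i p * D q i.+1.
Proof.
have := latdet_plucker (d i) (d i.+1) (d p) (d q).
rewrite (fan_basis fan) (latdetC (d p) (d i.+1)) (latdetC (d q) (d i.+1)).
by move=> h; lia.
Qed.

(** The first sign change after [i] locates a cone of consecutive directions that contains [w]. *)
Lemma fan_cover i w : 0 < latdet (d i) w ->
  exists a, [/\ (i <= a)%N, 0 < latdet (d a) w & latdet (d a.+1) w <= 0].
Proof.
move=> iw; have [j jw] := fan_complete fan iw.
(* The witness makes [i + t] equal to [j + i * K], a periodic copy of [j] that is not before [i]. *)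
have ex : exists t, latdet (d (i + t)%N) w <= 0.
  exists (j + i * K - i)%N; rewrite subnKC ?fan_periodicM ?ltW//.
  by have := fan_pos fan; nia.
have [[|t] tw tmin] := ex_minnP ex; first by move: tw; rewrite addn0 leNgt iw.
exists (i + t)%N; rewrite leq_addr -addnS; split=> //.
by rewrite ltNge; apply/negP => /tmin; rewrite ltnn.
Qed.

Definition fan_opposite i := exists j, d j = - d i.

Section Bound.
Variables (R : realFieldType) (phi : R).
Hypotheses (phi1 : 1 <= phi) (phi2 : phi ^+ 2 = phi + 1).

(** The values [D i t] around [l] form a positive run between two zeros, of length at most [K] by
    periodicity. They cannot jump across zero, because neither [d i] nor its opposite lies in an
    open cone of consecutive directions. *)
Lemma opposite_bound i l : fan_opposite i -> (D i l)%:~R * phi <= phi ^+ K.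
Proof.
move=> [j0 dj0].
have [il|il] := leP (D i l) 0.
  have phi0 : 0 < phi by apply: lt_le_trans phi1.
  by apply: (@le_trans _ _ 0); [rewrite pmulr_lle0// lerz0|exact/exprn_ge0/ltW].
have K0 := fan_pos fan.
(* [s] is a copy of [l] beyond [i]; [a] and [b] below are the nearest indices on its two sides with
   a nonpositive value. *)
pose s := (l + i.+1 * K)%N.
have ds : d s = d l by exact: fan_periodicM.
have is_ : (i <= s)%N by rewrite /s; nia.
have exl : exists p, (p <= s)%N && (D i p <= 0).
  by exists i; rewrite is_ latdetvv lexx.
have bnd p : (p <= s)%N && (D i p <= 0) -> (p <= s)%N by case/andP.
have [a /andP[as_ ia] amax] := ex_maxnP exl bnd.
have exr : exists p, (s <= p)%N && (D i p <= 0).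
  exists (i + s * K)%N; rewrite fan_periodicM latdetvv lexx andbT.
  by nia.
have [b /andP[sb ib] bmin] := ex_minnP exr.
have inside t : (a < t < b)%N -> 0 < D i t.
  move=> /andP[at_ tb]; rewrite ltNge; apply/negP => it.
  have [ts|st] := leqP t s.
    by have := amax t; rewrite ts it => /(_ isT); lia.
  by have := bmin t; rewrite (ltnW st) it => /(_ isT); lia.
have aNs : a != s by apply/eqP => as'; move: ia; rewrite as' ds; lia.
have bNs : b != s by apply/eqP => bs'; move: ib; rewrite bs' ds; lia.
have ia1 : 0 < D i a.+1 by apply: inside; lia.
have a0 : D i a = 0.
  have [//|ne] := eqVneq (D i a) 0.
  by have := @fan_empty _ _ fan a i; rewrite latdetC; lia.
have a1 : D i a.+1 = 1.
  have a0' : D a i = 0 by rewrite latdetC a0 oppr0.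
  by have := fan_basis fan i; rewrite (fan_coord a) a0' mul0r subr0 => /pos_mulz_eq1->.
have b0 : D i b = 0.
  have [//|ne] := eqVneq (D i b) 0.
  have ib1 : 0 < D i b.-1 by apply: inside; lia.
  have := @fan_empty _ _ fan b.-1 j0; rewrite prednK; last by lia.
  by rewrite dj0 latdetNr latdetNl (latdetC (d i)); lia.
have bK : (b <= a + K)%N.
  rewrite leqNgt; apply/negP => aKb.
  by have := inside (a + K)%N; rewrite (fan_periodic fan) a0 aKb; lia.
have [] := @fibonacci_bound R phi (b - a) (fun t => D i (a + t)%N) phi1 phi2 _ _ _ _ _ (s - a)%N _.
- by rewrite addn0.
- by rewrite addn1.
- by rewrite subnKC//; lia.
- by move=> t tb; apply: inside; lia.
(* The Plücker relation for three consecutive directions is the three-term recurrence. *)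
- move=> t tb; exists (D (a + t)%N (a + t).+2).
  rewrite !addnS.
  have := latdet_plucker (d i) (d (a + t)%N) (d (a + t).+1) (d (a + t).+2).
  by rewrite !(fan_basis fan); nia.
- by lia.
rewrite subnKC// ds => le _; apply: (le_trans le).
by apply: ler_weXn2l => //; lia.
Qed.

End Bound.

(** The two clauses exclude directions in the open second and fourth quadrants, respectively, unless
    an opposite is available. Each yields an upper bound on one coordinate. *)
Definition good_corner i :=
  (fan_opposite i \/ forall l, 0 < D i l -> D l i.+1 < 0 -> False) /\
  (fan_opposite i.+1 \/ forall l, D i l < 0 -> 0 < D l i.+1 -> False).

(** Without an opposite, a direction with one positive coordinate has the other equal to zero, since
    both adjacent open quadrants are empty; unit determinants then make the positive coordinate
    1. *)
Lemma good_corner_bound (R : realFieldType) (phi : R) i l :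
  1 <= phi -> phi ^+ 2 = phi + 1 -> good_corner i ->
  (D i l)%:~R * phi <= phi ^+ K /\ (D l i.+1)%:~R * phi <= phi ^+ K.
Proof.
move=> phi1 phi2 [good1 good2].
have le1 (x : int) : x <= 1 -> x%:~R * phi <= phi ^+ K.
  move=> x1; have : x%:~R <= 1 :> R by rewrite -[1]/(1%:~R) ler_int.
  have : phi ^+ 1 <= phi ^+ K by apply: ler_weXn2l => //; exact: fan_pos fan.
  by rewrite expr1; nra.
have empty := @fan_empty _ _ fan i l.
have coord := fan_coord i l l.+1; rewrite (fan_basis fan) in coord.
split.
  case: good1 => [opp|noII]; first exact: opposite_bound.
  apply: le1; have [il|il] := leP (D i l) 0; first by lia.
  have [/(noII l il)[]|/(empty il)[]|x0] := ltgtP (D l i.+1) 0.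
  by move: coord; rewrite x0 mul0r sub0r -mulrN => /esym/(pos_mulz_eq1 il)->.
case: good2 => [[j dj]|noIV].
  (* [D l i.+1] equals [D j l] for the opposite [d j] of [d i.+1]. *)
  have : fan_opposite j by exists i.+1; rewrite dj opprK.
  by move=> /(@opposite_bound _ _ phi1 phi2 j l); rewrite dj latdetNl -latdetC.
apply: le1; have [il|il] := leP (D l i.+1) 0; first by lia.
have [/noIV/(_ il)[]|/empty/(_ il)[]|y0] := ltgtP (D i l) 0.
by move: coord; rewrite y0 mul0r subr0 => /esym/(pos_mulz_eq1 il)->.
Qed.

Lemma neg_mulz_eq1 (x y : int) : x < 0 -> x * y = 1 -> x = -1 /\ y = -1.
Proof.
move=> x0; rewrite -mulrNN => xy.
have nx : - x = 1 by apply: pos_mulz_eq1 xy; lia.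
by move: xy; rewrite nx mul1r; lia.
Qed.

Lemma fan_opposite_fst i q : D i q = 0 -> D q i.+1 = -1 -> fan_opposite i.
Proof.
move=> y0 x1; exists q; rewrite (lattice_coordE (d q) (fan_basis fan i)) y0 x1.
by rewrite mulr0z addr0 mulrN1z.
Qed.

Lemma fan_opposite_snd i q : D q i.+1 = 0 -> D i q = -1 -> fan_opposite i.+1.
Proof.
move=> x0 y1; exists q; rewrite (lattice_coordE (d q) (fan_basis fan i)) x0 y1.
by rewrite mulr0z add0r mulrN1z.
Qed.

(** Unit determinant and [fan_empty] force [d a.+1 = d i] and put [d a] at height -1 in the third
    quadrant. The open cone between them then contains the whole open fourth quadrant. *)
Lemma fan_emptyIV i a l :
  D a i.+1 < 0 -> 0 < D a.+1 i.+1 -> D i a < 0 ->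
  D i l < 0 -> 0 < D l i.+1 -> False.
Proof.
move=> xa xa1 ya yl xl.
have E := fan_coord i a a.+1; rewrite (fan_basis fan) in E.
have ya1 : D i a.+1 = 0.
  have ya1 : 0 <= D i a.+1 by move: E xa xa1 ya; clear; nia.
  by have := @fan_empty _ _ fan i a.+1; lia.
have [ya_1 xa1_1] : D i a = -1 /\ - D a.+1 i.+1 = -1.
  by apply: neg_mulz_eq1 => //; rewrite E ya1; ring.
apply: (@fan_empty _ _ fan a l); rewrite (fan_coord i).
  by move: xa yl xl; rewrite ya_1; clear; nia.
by rewrite ya1; move: xa1 yl; clear; nia.
Qed.

(** At corner [i], [d j.+1] has coordinates [(-t, -1)] with [t >= 0]. If [t = 0] it is opposite to
    [d i.+1]. Otherwise the cone around [- d i.+1] must start in the open third quadrant, as it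
    would contain [d j.+1] if it started higher, and [fan_emptyIV] applies. *)
Lemma good_corner_opposite i j :
  d j = - d i -> 0 <= D i.+1 j.+1 -> good_corner i.
Proof.
move=> dj t0; split; first by left; exists j.
have [opp|nopp] := pselect (fan_opposite i.+1); [by left|right=> l yl xl].
have xj : D j.+1 i.+1 = - D i.+1 j.+1 by rewrite latdetC.
have yj : D i j.+1 = -1.
  by rewrite -(opprK (d i)) -dj latdetNl (fan_basis fan).
have {t0} t0 : 0 < D i.+1 j.+1.
  rewrite lt_neqAle t0 andbT; apply/eqP => t0'; apply: nopp.
  by apply: fan_opposite_snd yj; rewrite xj -t0' oppr0.
have [|a [_]] := @fan_cover j.+1 (- d i.+1).
  by rewrite latdetNr xj opprK.
rewrite !latdetNr oppr_gt0 oppr_le0 => xa xa1.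
have E := fan_coord i a a.+1; rewrite (fan_basis fan) in E.
have {}xa1 : 0 < D a.+1 i.+1.
  rewrite lt_neqAle xa1 andbT; apply/eqP => xa0; apply: nopp.
  have [|_] := @neg_mulz_eq1 (D a i.+1) (D i a.+1) xa; last exact: fan_opposite_snd.
  by rewrite E -xa0 mulr0 subr0.
apply: (fan_emptyIV xa xa1 _ yl xl); rewrite ltNge; apply/negP => ya.
have ya1 : D i a.+1 < 0 by move: E xa xa1 ya; clear; nia.
apply: (@fan_empty _ _ fan a j.+1); rewrite (fan_coord i) yj xj.
  by move: xa t0 ya; clear; nia.
by move: t0 ya1 xa1; clear; nia.
Qed.

(* Without opposite edge directions, a corner violating good_corner has its
   negative in the interior of the cone of another corner a. *)
Lemma bad_corner_cone i :
  (forall j, ~ fan_opposite j) -> ~ good_corner i ->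
  exists a, [/\ D a i.+1 < 0, 0 < D i a, 0 < D a.+1 i.+1 & D i a.+1 < 0].
Proof.
move=> nopp bad.
have [[l [yl xl]]|noII] := pselect (exists l, 0 < D i l /\ D l i.+1 < 0).
  have [|a [_]] := @fan_cover i.+1 (- d i).
    by rewrite latdetNr -latdetC (fan_basis fan).
  rewrite !latdetNr -!latdetC => ya ya1.
  have E := fan_coord i a a.+1; rewrite (fan_basis fan) in E.
  have {}ya1 : D i a.+1 < 0.
    rewrite lt_neqAle ya1 andbT; apply/eqP => ya0.
    have [||_ x1] := @neg_mulz_eq1 (- D i a) (D a.+1 i.+1); [by rewrite oppr_lt0| |].
      by rewrite E ya0 mulr0 sub0r mulNr.
    exact: nopp (fan_opposite_fst ya0 x1).
  have xa : D a i.+1 <= 0.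
    by rewrite leNgt; apply/negP => /(@fan_empty _ _ fan i a ya).
  have {}xa : D a i.+1 < 0.
    (* If [d a] were [d i.+1], the open cone from it to [d a.+1] would contain the second-quadrant
       direction [d l]. *)
    rewrite lt_neqAle xa andbT; apply/eqP => xa0.
    have [||ya_1 xa1] := @neg_mulz_eq1 (- D i a) (D a.+1 i.+1); [by rewrite oppr_lt0| |].
      by rewrite E xa0 mul0r sub0r mulNr.
    apply: (@fan_empty _ _ fan a l); rewrite (fan_coord i) ?xa0 ?xa1.
      by move: ya xl; clear; nia.
    by move: xl yl ya1; clear; nia.
  exists a; split => //.
  rewrite lt_neqAle; apply/andP; split; last by move: E ya ya1 xa; clear; nia.
  apply/eqP => xa1.
  have [|_] := @neg_mulz_eq1 (D a i.+1) (D i a.+1) xa.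
    by rewrite E -xa1 mulr0 subr0.
  by move=> /(fan_opposite_snd (esym xa1)); exact: nopp.
have [[l [yl xl]]|noIV] := pselect (exists l, D i l < 0 /\ 0 < D l i.+1); last first.
  by case: bad; split; right => l y x; [apply: noII|apply: noIV]; exists l.
have [|a [_]] := @fan_cover i.+2 (- d i.+1).
  by rewrite latdetNr -latdetC (fan_basis fan).
rewrite !latdetNr oppr_gt0 oppr_le0 => xa xa1.
have E := fan_coord i a a.+1; rewrite (fan_basis fan) in E.
have {}xa1 : 0 < D a.+1 i.+1.
  rewrite lt_neqAle xa1 andbT; apply/eqP => xa0.
  have [|_] := @neg_mulz_eq1 (D a i.+1) (D i a.+1) xa.
    by rewrite E -xa0 mulr0 subr0.
  by move=> /(fan_opposite_snd (esym xa0)); exact: nopp.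
exists a; have [ya|ya|ya] := ltgtP (D i a) 0.
- by case: (fan_emptyIV xa xa1 ya yl xl).
- by split => //; move: E xa xa1 ya; clear; nia.
- have [|x1 _] := @neg_mulz_eq1 (D a i.+1) (D i a.+1) xa.
    by rewrite E ya mul0r subr0.
  by case: (nopp i); exact: fan_opposite_fst ya x1.
Qed.

(** For an opposite pair [i], [j], the sign of [D i.+1 j.+1] decides which of the two is good.
    Without opposites, bad corners 0 and [a] would give a corner [b] whose open cone contains the
    twice negated cone of corner 0, hence [d 0]. *)
Lemma exists_good_corner : exists i, good_corner i.
Proof.
have [[i [j dj]]|nopp] := pselect (exists i, fan_opposite i).
  have [t0|t0] := leP 0 (D i.+1 j.+1); first by exists i; exact: good_corner_opposite dj t0.
  exists j; apply: (@good_corner_opposite j i); first by rewrite dj opprK.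
  by rewrite latdetC oppr_ge0 ltW.
have {}nopp j : ~ fan_opposite j by move=> oj; apply: nopp; exists j.
have [|/(bad_corner_cone nopp)[a [xa ya xa1 ya1]]] := pselect (good_corner 0%N).
  by exists 0%N.
have [|/(bad_corner_cone nopp)[b [xb yb xb1 yb1]]] := pselect (good_corner a).
  by exists a.
case: (@fan_empty _ _ fan b 0%N); rewrite (fan_coord a) !(latdetC (d 0%N) (d a)).
  by move: xb ya yb ya1; clear; nia.
by move: xb1 ya yb1 ya1; clear; nia.
Qed.

End Fan.

(** * Corners of a smooth polygon *)

(** Expressing the standard basis in [d], [e] gives an inverse integer matrix, so the determinant
    divides 1. *)
Lemma lattice_basis_det (d e : lattice) : lattice_basis d e ->
  latdet d e = 1 \/ latdet d e = -1.
Proof.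
move=> de; have [[a b] [/= E1 _]] := de (1, 0); have [[a' b'] [/= E2 _]] := de (0, 1).
move: E1 E2; rewrite !lattice_mulrz => -[x1 y1] [x2 y2].
have : (a * b' - b * a') * latdet d e = 1.
  transitivity ((d.1 * a + e.1 * b) * (d.2 * a' + e.2 * b') -
     (d.2 * a + e.2 * b) * (d.1 * a' + e.1 * b')); first by rewrite /latdet; ring.
  by rewrite /= -x1 -x2 -y1 -y2; ring.
have [|l0|->] := ltgtP (latdet d e) 0; last by rewrite mulr0.
  by move=> l0; rewrite mulrC => /(neg_mulz_eq1 l0)[]; right.
by rewrite mulrC => /(pos_mulz_eq1 l0); left.
Qed.

Section Plane.
Variable R : realType.
Implicit Types (z u : R * R) (c d e m : lattice).
Local Notation lp := (@lattice_point R).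

(** This extends [latdet c] to real points; it is nonnegative to the left of the direction [c]. *)
Definition rdet c z : R := c.1%:~R * z.2 - c.2%:~R * z.1.

Lemma lattice_pointD m m' : lp (m + m') = lp m + lp m'.
Proof. by rewrite /lattice_point /= !intrD. Qed.

Lemma lattice_pointN m : lp (- m) = - lp m.
Proof. by rewrite /lattice_point /= !intrN. Qed.

Lemma lattice_pointB m m' : lp (m - m') = lp m - lp m'.
Proof. by rewrite lattice_pointD lattice_pointN. Qed.

Lemma lattice_pointMn m n : lp (m *+ n) = n%:R *: lp m.
Proof.
elim: n => [|n IH]; first by rewrite mulr0n scale0r.
by rewrite mulrS lattice_pointD IH -natr1 scalerDl scale1r addrC.
Qed.

Lemma lattice_point_inj : injective lp.
Proof. by move=> [a b] [a' b'] [/intr_inj-> /intr_inj->]. Qed.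

Lemma rdet_lattice c m : rdet c (lp m) = (latdet c m)%:~R.
Proof. by rewrite /rdet /latdet /= intrB !intrM. Qed.

Lemma rdetD c z z' : rdet c (z + z') = rdet c z + rdet c z'.
Proof. by rewrite /rdet /=; ring. Qed.

Lemma rdetB c z z' : rdet c (z - z') = rdet c z - rdet c z'.
Proof. by rewrite /rdet /=; ring. Qed.

Lemma rdetZ c a z : rdet c (a *: z) = a * rdet c z.
Proof. by rewrite /rdet /=; rewrite /GRing.scale /=; ring. Qed.

Lemma rdetN c z : rdet (- c) z = - rdet c z.
Proof. by rewrite /rdet /= !intrN; ring. Qed.

Lemma plane_coordE d e z : latdet d e = 1 ->
  z = (- rdet e z) *: lp d + rdet d z *: lp e.
Proof.
move=> /(congr1 (fun x : int => x%:~R : R)); rewrite /latdet intrB !intrM rmorph1 => de.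
case: z => x y; rewrite /rdet /lattice_point.
by congr pair; rewrite /= /GRing.scale /= -[LHS]mul1r -[1 in LHS]de; ring.
Qed.

Lemma pairingD u z z' : pairing u (z + z') = pairing u z + pairing u z'.
Proof. by rewrite /pairing /=; ring. Qed.

Lemma pairingB u z z' : pairing u (z - z') = pairing u z - pairing u z'.
Proof. by rewrite /pairing /=; ring. Qed.

Lemma pairingZ u a z : pairing u (a *: z) = a * pairing u z.
Proof. by rewrite /pairing /= /GRing.scale /=; ring. Qed.

Lemma pairing_sum u n (w : 'I_n -> R) (x : 'I_n -> R * R) :
  pairing u (\sum_i w i *: x i) = \sum_i w i * pairing u (x i).
Proof.
elim/big_ind2 : _ => [|z a z' b <- <-|i _]; last by rewrite pairingZ.
  by rewrite /pairing /= !mulr0 addr0.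
by rewrite pairingD.
Qed.

Section Hull.
Variables (N : nat) (x : 'I_N -> R * R).

Lemma conv_hull_bound u M z :
  (forall i, pairing u (x i) <= M) -> conv_hull x z -> pairing u z <= M.
Proof.
move=> uM [w [w0 w1 ->]]; rewrite pairing_sum -[leRHS]mul1r -w1 mulr_suml.
by apply: ler_sum => i _; exact: ler_wpM2l.
Qed.

Lemma conv_hull_gen i : conv_hull x (x i).
Proof.
exists (fun j => (j == i)%:R); split; first by move=> j; rewrite ler0n.
  by rewrite (bigD1 i)//= eqxx big1 ?addr0// => j /negbTE->.
rewrite (bigD1 i)//= eqxx scale1r big1 ?addr0// => j /negbTE->.
by rewrite scale0r.
Qed.

Lemma conv_hull_convex z z' (t : R) : 0 <= t <= 1 ->
  conv_hull x z -> conv_hull x z' -> conv_hull x (z + t *: (z' - z)).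
Proof.
move=> /andP[t0 t1] [w [w0 w1 ->]] [w' [w'0 w'1 ->]].
exists (fun i => w i + t * (w' i - w i)); split.
- move=> i; have -> : w i + t * (w' i - w i) = (1 - t) * w i + t * w' i by ring.
  by rewrite addr_ge0 ?mulr_ge0 ?subr_ge0.
- by rewrite big_split /= -mulr_sumr sumrB w1 w'1 subrr mulr0 addr0.
- rewrite -sumrB scaler_sumr -big_split /=; apply: eq_bigr => i _.
  by rewrite scalerDl -scalerBl scalerA.
Qed.

Lemma conv_hull_argmax u z : conv_hull x z ->
  exists i, forall j, pairing u (x j) <= pairing u (x i).
Proof.
move=> [w [_ w1 _]].
case: N x w w1 => [|n] y w w1; first by move: w1; rewrite big_ord0 => /esym/eqP; rewrite oner_eq0.
have [i _ imax] := @Order.TotalTheory.arg_maxP _ _ 'I_n.+1 ord0 xpredT (fun j => pairing u (y j)) isT.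
by exists i => j; exact: imax.
Qed.

End Hull.
(* The edges of P at the vertex m have directions d and e, and P lies in the cone
   m + cone (d, e). *)
Record corner (P : set (R * R)) m d e : Prop := Corner {
  corner_basis : latdet d e = 1;
  corner_mem : P (lp m);
  corner_left : forall z, P z -> 0 <= rdet d (z - lp m);
  corner_right : forall z, P z -> rdet e (z - lp m) <= 0;
  corner_fst : exists2 t : R, 0 < t & P (lp m + t *: lp d);
  corner_snd : exists2 t : R, 0 < t & P (lp m + t *: lp e) }.

(** The functional supporting an edge vanishes on its direction, hence is a multiple of the
    corresponding [rdet]. The point of [P] on the other edge fixes the sign. *)
Lemma corner_of_edge_directions P v d e : latdet d e = 1 ->
  primitive_edge_direction P v d -> primitive_edge_direction P v e ->
  forall m, v = lp m -> corner P m d e.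
Proof.
move=> de [_ [u [u0 [Pv uv] [t t0 [Pt ut]]]]] [_ [u' [u'0 [_ u'v] [t' t'0 [Pt' u't]]]]] m vm.
subst v.
have ud : pairing u (lp d) = 0.
  have := ut _ Pv; have := uv _ Pt; rewrite !pairingD pairingZ.
  by set p := pairing u (lp d) => h1 h2; nra.
have ue : pairing u' (lp e) = 0.
  have := u't _ Pv; have := u'v _ Pt'; rewrite !pairingD pairingZ.
  by set p := pairing u' (lp e) => h1 h2; nra.
have nz w : w != 0 -> pairing w (lp d) = 0 -> pairing w (lp e) = 0 -> False.
  move=> w0 wd we; case/negP: w0; apply/eqP.
  have w_ z : pairing w z = 0.
    by rewrite (plane_coordE z de) pairingD !pairingZ wd we !mulr0 addr0.
  have := w_ (1, 0); have := w_ (0, 1); rewrite /pairing /= !mulr0 !mulr1 addr0 add0r.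
  by case: w {w_ wd we} => a b /= -> ->.
have uE z : P z -> rdet d (z - lp m) * pairing u (lp e) <= 0.
  move=> Pz; have := uv z Pz; rewrite -subr_le0 -pairingB.
  by rewrite {1}(plane_coordE (z - lp m) de) pairingD !pairingZ ud mulr0 add0r.
have u'E z : P z -> 0 <= rdet e (z - lp m) * pairing u' (lp d).
  move=> Pz; have := u'v z Pz; rewrite -subr_le0 -pairingB.
  rewrite {1}(plane_coordE (z - lp m) de) pairingD !pairingZ ue mulr0 addr0.
  by rewrite mulNr oppr_le0.
have due : pairing u (lp e) < 0.
  rewrite lt_neqAle; apply/andP; split; first by apply/eqP => /(nz u u0 ud).
  have := uE _ Pt'; rewrite addrC addKr rdetZ rdet_lattice de mulr1.
  by rewrite pmulr_rle0.
have du'd : pairing u' (lp d) < 0.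
  rewrite lt_neqAle; apply/andP; split.
    by apply/eqP => h; exact: nz u' u'0 h ue.
  have := u'E _ Pt; rewrite addrC addKr rdetZ rdet_lattice latdetC de.
  by rewrite rmorphN1 mulrN1 mulNr oppr_ge0 pmulr_rle0.
split=> //.
- by move=> z /uE; rewrite nmulr_lle0.
- by move=> z /u'E; rewrite nmulr_lge0.
- by exists t.
- by exists t'.
Qed.

(** Each first direction lies weakly left of the other, so they are parallel, and likewise the
    second directions; the signs follow from the unit determinants. Thus a vertex determines its
    edge directions. *)
Lemma corner_uniq P m d e d' e' :
  corner P m d e -> corner P m d' e' -> d = d' /\ e = e'.
Proof.
case=> de _ Pd Pe [t t0 td] [s s0 se].
case=> de' _ Pd' Pe' [t' t'0 td'] [s' s'0 se'].
have sgn (c f : lattice) r : 0 < r -> 0 <= rdet c (lp m + r *: lp f - lp m) -> 0 <= latdet c f.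
  by move=> r0; rewrite addrAC subrr add0r rdetZ rdet_lattice pmulr_rge0// ler0z.
have sgn' (c f : lattice) r : 0 < r -> rdet c (lp m + r *: lp f - lp m) <= 0 -> latdet c f <= 0.
  by move=> r0; rewrite addrAC subrr add0r rdetZ rdet_lattice pmulr_rle0// lerz0.
have dd' : latdet d d' = 0.
  have := sgn _ _ _ t'0 (Pd _ td'); have := sgn _ _ _ t0 (Pd' _ td).
  by rewrite (latdetC d d'); lia.
have ee' : latdet e e' = 0.
  have := sgn' _ _ _ s'0 (Pe _ se'); have := sgn' _ _ _ s0 (Pe' _ se).
  by rewrite (latdetC e e'); lia.
have dE : d' = d *~ latdet d' e.
  by rewrite {1}(lattice_coordE d' de) dd' mulr0z addr0.
have d'e1 : latdet d' e = 1.
  have ed' := sgn' _ _ _ t'0 (Pe _ td').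
  have c0 : 0 <= latdet d' e by rewrite latdetC; lia.
  have : latdet d' e * latdet d e' = 1.
    rewrite -[RHS]de' {2}dE lattice_mulrz.
    by set c := latdet d' e; rewrite /latdet /=; ring.
  case: (ltgtP (latdet d' e) 0) c0 => // [c0 _ /(pos_mulz_eq1 c0)//|-> _].
  by rewrite mul0r.
have dd : d = d' by rewrite dE d'e1 mulr1z.
split=> //; rewrite -dd in de' *.
by rewrite (lattice_coordE e' de) de' mulr1z (latdetC e e') ee' oppr0 mulr0z add0r.
Qed.

Section SmoothPolygon.
Variables (N : nat) (p : 'I_N -> lattice).
Local Notation P := (conv_hull (lp \o p)).
Hypothesis smoothP : smooth P.

(** A functional exposing [v] attains its maximum at a generator, so [v] is a lattice point.
    Swapping the two directions if necessary makes the determinant 1. *)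
Lemma corner_of_vertex v : vertices P v -> exists m d e, v = lp m /\ corner P m d e.
Proof.
move=> vP; have [u uv] := vP.
have [Pv uPv] : face P u v by rewrite uv.
have [i imax] := conv_hull_argmax u Pv.
have vE : v = lp (p i).
  suff : face P u (lp (p i)) by rewrite uv => /= ->.
  split; first exact: (@conv_hull_gen _ (lp \o p)).
  by move=> y Py; apply: conv_hull_bound Py.
have [d [e [dirE /lattice_basis_det de]]] := smoothP vP.
have Ed : primitive_edge_direction P v d by rewrite dirE; left.
have Ee : primitive_edge_direction P v e by rewrite dirE; right.
case: de => de; first by exists (p i), d, e; split; [|exact: corner_of_edge_directions vE].
exists (p i), e, d; split=> //; apply: corner_of_edge_directions vE => //.
by rewrite latdetC de opprK.
Qed.

(* The functional a - M b, where (a, b) are the coordinates at the corner and M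
   is large, is maximal on P exactly at the end of the edge in direction d. *)
Lemma corner_edge_end m d e : corner P m d e ->
  exists2 l, (0 < l)%N & vertices P (lp (m + d *+ l)).
Proof.
case=> de Pm Pd Pe [t t0 td] _.
pose a i := latdet (p i - m) e; pose b i := latdet d (p i - m).
pose S : int := \sum_i `|a i|.
have aS i : `|a i| <= S by rewrite /S (bigD1 i)//= lerDl sumr_ge0.
have b0 i : 0 <= b i.
  have := Pd _ (@conv_hull_gen _ (lp \o p) i).
  by rewrite /= -lattice_pointB rdet_lattice ler0z.
pose u (M : int) : R * R := ((e.2 + M * d.2)%:~R, (- e.1 - M * d.1)%:~R).
have uE M z : pairing (u M) z = - rdet e z - M%:~R * rdet d z.
  by rewrite /pairing /rdet /= !(intrD, intrB, intrN, intrM); ring.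
have uEB M z : pairing (u M) z = pairing (u M) (lp m)
    + (- rdet e (z - lp m) - M%:~R * rdet d (z - lp m)).
  by rewrite -uE -pairingD addrC subrK.
have uEp M i : pairing (u M) (lp (p i)) = pairing (u M) (lp m) + (a i - M * b i)%:~R.
  rewrite uEB -lattice_pointB !rdet_lattice; congr (_ + _).
  by rewrite /a (latdetC e) intrD !intrN intrM.
have [i0 i0max] := conv_hull_argmax (u (S + 1)) Pm.
have {}i0max i : a i - (S + 1) * b i <= a i0 - (S + 1) * b i0.
  by have := i0max i; rewrite /= !uEp lerD2l ler_int.
pose L := a i0 - (S + 1) * b i0.
have L0 : 0 < L.
  rewrite -(ltr0z R); apply: (lt_le_trans t0).
  have : pairing (u (S + 1)) (lp m + t *: lp d) <= pairing (u (S + 1)) (lp m) + L%:~R.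
    by apply: conv_hull_bound td => i; rewrite /= uEp lerD2l ler_int; exact: i0max.
  rewrite uEB lerD2l (addrC (lp m)) addrK !rdetZ !rdet_lattice latdetvv (latdetC d e) de.
  by rewrite mulr0 mulr0 subr0 intrN mulrN1 opprK.
(* A positive [b i0] would give [L <= S - (S + 1) < 0]. *)
have bi0 : b i0 = 0.
  have [//|ne] := eqVneq (b i0) 0.
  have b1 : 0 < b i0 by rewrite lt_neqAle eq_sym ne b0.
  have := aS i0; rewrite /L in L0; move: L0 b1; generalize (a i0) (b i0) S; clear.
  by move=> x y z; nia.
have LE : L = a i0 by rewrite /L bi0 mulr0 subr0.
have pE : p i0 = m + d *+ `|L|%N.
  apply/eqP; rewrite addrC -subr_eq; apply/eqP.
  rewrite (lattice_coordE (p i0 - m) de) -/(a i0) -/(b i0) bi0 mulr0z addr0 -LE.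
  by rewrite -[in LHS](gez0_abs (ltW L0)).
exists `|L|%N; first by rewrite absz_gt0 gt_eqF.
(* The bound [L] holds for both slopes. A point attaining it with slope [S + 1] therefore has second
   coordinate zero, which makes the maximizer unique. *)
have bound M i : M = S + 1 \/ M = S -> a i - M * b i <= L.
  case=> ->; first exact: i0max.
  have := i0max i; have := aS i; have := b0 i; rewrite -/L; move: L0.
  generalize L (a i) (b i) S; clear => L x y z L0 y0 xz.
  have [->|ne] := eqVneq y 0; first by rewrite !mulr0.
  by move=> _; nia.
have hull M z : M = S + 1 \/ M = S -> P z ->
    - rdet e (z - lp m) - M%:~R * rdet d (z - lp m) <= L%:~R.
  move=> MS Pz; rewrite -(lerD2l (pairing (u M) (lp m))) -uEB.
  by apply: conv_hull_bound Pz => i; rewrite /= uEp lerD2l ler_int; exact: bound.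
have P0 : P (lp (p i0)) by exact: (@conv_hull_gen _ (lp \o p)).
rewrite -pE; exists (u (S + 1)); apply/seteqP; split=> z /=; last first.
  move=> ->; split=> // y Py; rewrite uEp uEB lerD2l -/L.
  by apply: hull => //; left.
move=> [Pz /(_ _ P0)]; rewrite uEp (uEB _ z) lerD2l -/L => zL.
have h1 := hull _ _ (or_introl erefl) Pz; have h2 := hull _ _ (or_intror erefl) Pz.
have dz := Pd _ Pz.
have dz0 : rdet d (z - lp m) = 0 by move: zL h2; rewrite intrD; lra.
have ez : - rdet e (z - lp m) = L%:~R by move: zL h1; rewrite dz0; lra.
have LR : L%:~R = (`|L|%N)%:R :> R by rewrite -{1}(gez0_abs (ltW L0)).
rewrite -(subrK (lp m) z) (plane_coordE (z - lp m) de) dz0 scale0r addr0 ez LR.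
by rewrite pE lattice_pointD lattice_pointMn addrC.
Qed.

(** At the far end, [P] being left of [d] and [m] being right of the second direction [e'] make [e']
    parallel to [d]; the sign of [latdet d d'] leaves only [- d]. *)
Lemma corner_next m d e : corner P m d e ->
  exists l d', [/\ (0 < l)%N, vertices P (lp (m + d *+ l)) &
    corner P (m + d *+ l) d' (- d)].
Proof.
move=> c; have [l l0 lV] := corner_edge_end c.
have [m' [d' [e' [/lattice_point_inj E c']]]] := corner_of_vertex lV; subst m'.
exists l, d'; split => //.
have de := corner_basis c; have de' := corner_basis c'.
have sgn (f : lattice) r : 0 < r -> P (lp (m + d *+ l) + r *: lp f) -> 0 <= latdet d f.
  move=> r0 /(corner_left c); rewrite lattice_pointD -(addrA (lp m)) (addrC (lp m)) addrK.
  rewrite rdetD rdet_lattice latdetMn latdetvv mul0rn add0r rdetZ rdet_lattice.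
  by rewrite pmulr_rge0// ler0z.
have [t' t'0 /(sgn _ _ t'0) dd'] := corner_fst c'.
have [s' s'0 /(sgn _ _ s'0) de'0] := corner_snd c'.
have := corner_right c' (corner_mem c).
rewrite -lattice_pointB opprD addrA subrr sub0r rdet_lattice latdetNr latdetMn lerz0.
rewrite oppr_le0 pmulrn_lge0// latdetC oppr_ge0 => de'1.
have {de'0 de'1} de'0 : latdet d e' = 0 by lia.
have dE : d = e' *~ latdet d' d.
  by rewrite {1}(lattice_coordE d de') de'0 mulr0z add0r.
have : latdet d' d * latdet e' e = 1.
  rewrite -[RHS]de {2}dE lattice_mulrz.
  by set q := latdet d' d; rewrite /latdet /=; ring.
have : latdet d' d <= 0 by rewrite latdetC oppr_le0.
case: (ltgtP (latdet d' d) 0) => // [q0 _ /(neg_mulz_eq1 q0)[q1 _]|-> _]; last by rewrite mul0r.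
by move: dE; rewrite q1 mulrN1z => dE; rewrite {2}dE opprK.
Qed.

End SmoothPolygon.
End Plane.

(** * The boundary cycle *)

Lemma uniq_size_card_le (T : choiceType) (s : seq T) (A : set T) n :
  uniq s -> (forall x, x \in s -> A x) -> A #= `I_n -> (size s <= n)%N.
Proof.
move=> us sA An; rewrite -(card_fset_set An); apply: uniq_leq_size => // x /sA Ax.
by rewrite in_fset_set ?inE//; exists n.
Qed.

(* m i are the vertices in counterclockwise order, the i-th edge runs from m i in
   the primitive direction d i and has lattice length l i; indices are mod K. *)
Record polygon_cycle (R : realType) (P : set (R * R)) (K : nat)
    (m d : nat -> lattice) (l : nat -> nat) : Prop := PolygonCycle {
  cycle_pos : (0 < K)%N;
  cycle_vertexP : forall i, m (i + K)%N = m i;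
  cycle_edgeP : forall i, d (i + K)%N = d i;
  cycle_lengthP : forall i, l (i + K)%N = l i;
  cycle_length_gt0 : forall i, (0 < l i)%N;
  cycle_step : forall i, m i.+1 = m i + d i *+ l i;
  cycle_corner : forall i, corner P (m i.+1) (d i.+1) (- d i);
  cycle_inj : forall i j, (i < K)%N -> (j < K)%N -> m i = m j -> i = j }.

(** Iterating [corner_next] from a vertex must repeat a state, as there are only [k] vertices. A
    shortest period visits distinct vertices, whence [K <= k]. *)
Lemma exists_polygon_cycle (R : realType) (N : nat) (p : 'I_N -> lattice) (k : nat) :
  let P := conv_hull (@lattice_point R \o p) in
  smooth P -> (0 < k)%N -> vertices P #= `I_k ->
  exists K m d l, (K <= k)%N /\ polygon_cycle P K m d l.
Proof.
move=> P smoothP k0 Vk.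
have [v vV] : vertices P !=set0.
  apply/set0P/eqP => V0; move: Vk; rewrite V0 card_eq_sym card_eq0 => /eqP I0.
  by have : `I_k 0%N by []; rewrite I0.
have [m0 [d0 [e0 [vE c0]]]] := corner_of_vertex smoothP vV.
have /choice[f fP] : forall s : lattice * lattice * lattice, exists r : nat * lattice,
    corner P s.1.1 s.1.2 s.2 -> [/\ (0 < r.1)%N,
      vertices P (lattice_point R (s.1.1 + s.1.2 *+ r.1)) &
      corner P (s.1.1 + s.1.2 *+ r.1) r.2 (- s.1.2)].
  move=> [[m d] e] /=.
  (* Triples that are not corners get a default value, which the walk never meets. *)
  have [c|nc] := pselect (corner P m d e); last by exists (0%N, 0).
  by have [l [d' c']] := corner_next smoothP c; exists (l, d').
pose g s : lattice * lattice * lattice :=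
  ((s.1.1 + s.1.2 *+ (f s).1), (f s).2, - s.1.2).
pose s i := iter i g (m0, d0, e0).
have sc i : corner P (s i).1.1 (s i).1.2 (s i).2.
  by elim: i => [//|i /fP[]].
have sE i j : (s i).1.1 = (s j).1.1 -> s i = s j.
  have := sc i; have := sc j; case: (s i) (s j) => [[a b] c] [[a' b'] c'] /=.
  by move=> h h' E; subst a'; have [-> ->] := corner_uniq h' h.
have sV i : vertices P (lattice_point R (s i).1.1).
  by case: i => [|i]; [rewrite -vE|have [] := fP _ (sc i)].
have inj_le i0 L :
    (forall i j, (i < j < L)%N -> s (i0 + i)%N <> s (i0 + j)%N) -> (L <= k)%N.
  move=> sinj.
  rewrite -(size_iota 0 L) -(size_map (fun i => lattice_point R (s (i0 + i)%N).1.1)).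
  apply: uniq_size_card_le Vk; last by move=> x /mapP[i _ ->]; exact: sV.
  rewrite map_inj_in_uniq ?iota_uniq// => i j; rewrite !mem_iota !add0n /= => iL jL.
  move=> /lattice_point_inj/sE E.
  by have [ij|ij|//] := ltngtP i j; [case: (sinj i j)|case: (sinj j i)]; rewrite ?ij.
have exK : exists K, (0 < K)%N && `[< exists i, s (i + K)%N = s i >].
  have [[i [j [ij E]]]|nrep] := pselect (exists i j, (i < j)%N /\ s i = s j).
    exists (j - i)%N; rewrite subn_gt0 ij; apply/asboolP.
    by exists i; rewrite subnKC// ltnW.
  suff kk : (k.+1 <= k)%N by rewrite ltnn in kk.
  by apply: (inj_le 0%N) => i j /andP[ij _] E; apply: nrep; exists i, j.
have [K /andP[K0 /asboolP[i0 Ki0]] Kmin] := ex_minnP exK.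
have nrepK i j : (i < j < K)%N -> s (i0 + i)%N <> s (i0 + j)%N.
  move=> /andP[ij jK] E.
  have /Kmin : (0 < j - i)%N && `[< exists a, s (a + (j - i))%N = s a >].
    rewrite subn_gt0 ij; apply/asboolP; exists (i0 + i)%N.
    by rewrite -addnA subnKC// ltnW.
  by lia.
have per i : (i0 <= i)%N -> s (i + K)%N = s i.
  move=> /subnK<-; rewrite -addnA /s iterD [RHS]iterD.
  by congr iter; exact: Ki0.
exists K, (fun i => (s (i0 + i)%N).1.1), (fun i => (s (i0 + i)%N).1.2), (fun i => (f (s (i0 + i)%N)).1).
split; [exact: inj_le nrepK|split=> //].
- by move=> i; rewrite addnA per// leq_addr.
- by move=> i; rewrite addnA per// leq_addr.
- by move=> i; rewrite addnA per// leq_addr.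
- by move=> i; have [] := fP _ (sc (i0 + i)%N).
- by move=> i; rewrite addnS.
- by move=> i; rewrite addnS; have [] := fP _ (sc (i0 + i)%N).
- move=> i j iK jK /sE E.
  by have [ij|ij|//] := ltngtP i j; [case: (nrepK i j)|case: (nrepK j i)]; rewrite ?ij.
Qed.

Section Cycle.
Variables (R : realType) (P : set (R * R)) (K : nat).
Variables (m d : nat -> lattice) (l : nat -> nat).
Hypothesis cycle : polygon_cycle P K m d l.
Local Notation lp := (@lattice_point R).

Lemma cycle_basis i : latdet (d i) (d i.+1) = 1.
Proof. by have := corner_basis (cycle_corner cycle i); rewrite latdetNr latdetC opprK. Qed.

Lemma cycle_edge_left i z : P z -> 0 <= rdet (d i) (z - lp (m i)).
Proof.
move=> /(corner_right (cycle_corner cycle i)).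
rewrite rdetN oppr_le0 (cycle_step cycle) lattice_pointD opprD addrA.
by rewrite (rdetB _ _ (lp (d i *+ l i))) rdet_lattice latdetMn latdetvv mul0rn subr0.
Qed.

Lemma cycle_corner_at i : exists e, corner P (m i) (d i) e.
Proof.
(* The predecessor of [i] is taken one period later, so that [i = 0] is covered. *)
exists (- d (i + K).-1); have := cycle_corner cycle (i + K).-1.
by rewrite prednK ?(cycle_vertexP cycle) ?(cycle_edgeP cycle)// ltn_addl// (cycle_pos cycle).
Qed.

Lemma cycle_mem i : P (lp (m i)).
Proof. by have [e /corner_mem] := cycle_corner_at i. Qed.

Lemma cycle_vertex_left i j : 0 <= latdet (d i) (m j - m i).
Proof.
by have := cycle_edge_left i (cycle_mem j); rewrite -lattice_pointB rdet_lattice ler0z.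
Qed.

Lemma cycle_edge_start_next i j : latdet (d i) (m j - m i.+1) = latdet (d i) (m j - m i).
Proof.
by rewrite (cycle_step cycle) opprD addrA [LHS]latdetBr latdetMn latdetvv mul0rn subr0.
Qed.

(** Emptiness follows from convexity at the vertex [m i.+1], completeness from the closing up of the
    cycle. *)
Lemma cycle_fan : edge_fan K d.
Proof.
split; [exact: cycle_pos cycle|exact: cycle_edgeP cycle|exact: cycle_basis| |].
- move=> i j ij ji.
  (* If [d j] were strictly between, [latdet (d j)] would be a positive combination of the two edge
     functionals at [m i.+1]. Both ends of edge [j] would then lie on the line of edge [i], against
     [ij]. *)
  have key q : 0 <= latdet (d j) (m i.+1 - m q) -> latdet (d i) (m q - m i.+1) = 0.
    have -> : m i.+1 - m q = - (m q - m i.+1) by rewrite opprB.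
    rewrite latdetNr oppr_ge0.
    have := latdet_plucker (d i) (d i.+1) (d j) (m q - m i.+1).
    have := cycle_vertex_left i q; rewrite -cycle_edge_start_next.
    have := cycle_vertex_left i.+1 q.
    rewrite cycle_basis (latdetC (d j) (d i.+1)); move: ij ji.
    generalize (latdet (d j) (m q - m i.+1)) (latdet (d i) (m q - m i.+1))
      (latdet (d i.+1) (m q - m i.+1)) (latdet (d i) (d j)) (latdet (d j) (d i.+1)).
    clear => w x y u v u0 v0 y0 x0 E w0.
    have uy : 0 <= u * y by rewrite mulr_ge0// ltW.
    have : x * v <= 0 by lia.
    by rewrite pmulr_lle0//; lia.
  have j0 := key j (cycle_vertex_left j i.+1).
  have := key j.+1; rewrite cycle_edge_start_next => /(_ (cycle_vertex_left j i.+1)).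
  rewrite (cycle_step cycle) addrAC latdetDr j0 add0r latdetMn => /eqP.
  by rewrite mulrn_eq0 (gt_eqF ij) eqn0Ngt (cycle_length_gt0 cycle).
(* Otherwise [latdet (m j) w] would never decrease around the cycle and increase strictly at edge
   [i]. *)
- move=> i w iw; apply: contrapT => nneg.
  have pos j : 0 <= latdet (d j) w.
    by rewrite leNgt; apply/negP => jw; apply: nneg; exists j.
  have step j : latdet (m j.+1) w = latdet (m j) w + latdet (d j) w * (l j)%:Z.
    by rewrite (cycle_step cycle) !(latdetC w) latdetDr latdetMn opprD -mulr_natr natz mulNr.
  have mono q : latdet (m i.+1) w <= latdet (m (i.+1 + q)%N) w.
    elim: q => [|q IH]; first by rewrite addn0.
    by rewrite addnS (step (i.+1 + q)%N); apply: (le_trans IH); rewrite lerDl mulr_ge0.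
  have := mono K.-1; rewrite addSnnS prednK ?(cycle_pos cycle)// (cycle_vertexP cycle).
  have := cycle_length_gt0 cycle i.
  rewrite step gerDl leNgt => l0; apply/negP; rewrite negbK.
  by rewrite mulr_gt0.
Qed.

(** The edges lie on one line. With opposite directions, [P] would lie on both sides of that line,
    but [m i'.+2] is strictly to the left of [d i']. *)
Lemma cycle_parallel_edges i i' :
  latdet (d i') (d i) = 0 -> latdet (d i') (m i - m i') = 0 -> d i = d i'.
Proof.
move=> dd g0.
have dE : d i = d i' *~ latdet (d i) (d i'.+1).
  by rewrite {1}(lattice_coordE (d i) (cycle_basis i')) dd mulr0z addr0.
have : latdet (d i) (d i'.+1) * latdet (d i') (d i.+1) = 1.
  rewrite -[RHS](cycle_basis i) {2}dE lattice_mulrz.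
  by set q := latdet (d i) _; rewrite /latdet /=; ring.
case: (ltgtP (latdet (d i) (d i'.+1)) 0) => [c0 /(neg_mulz_eq1 c0)[c1 _]|c0 /(pos_mulz_eq1 c0) c1|->].
- have := cycle_vertex_left i i'.+2; rewrite dE c1 mulrN1z latdetNl.
  have -> : m i'.+2 - m i = (m i'.+2 - m i') - (m i - m i') by rewrite opprB addrA subrK.
  rewrite latdetBr g0 subr0 -cycle_edge_start_next (cycle_step cycle i'.+1) addrAC subrr add0r.
  rewrite latdetMn cycle_basis oppr_ge0 natz lez_nat leqn0.
  by have := cycle_length_gt0 cycle i'.+1; lia.
- by rewrite dE c1 mulr1z.
- by rewrite mul0r.
Qed.

(** The functional of edge [i'] is nonnegative at both ends of edge [i] and zero at an inner point,
    hence zero along edge [i]. *)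
Lemma cycle_inner_point i i' j j' : (0 < j < l i)%N ->
  m i + d i *+ j = m i' + d i' *+ j' -> d i = d i'.
Proof.
move=> /andP[j0 jl] E.
have g0 := cycle_vertex_left i' i; have := cycle_vertex_left i' i.+1.
have -> : m i.+1 - m i' = (m i - m i') + d i *+ l i by rewrite (cycle_step cycle) addrAC.
have : latdet (d i') (m i - m i' + d i *+ j) = 0.
  by rewrite addrAC E addrAC subrr add0r latdetMn latdetvv mul0rn.
rewrite !(latdetDr _ (m i - m i')) !latdetMn -![latdet _ (d i) *+ _]mulr_natr !natz => Ej gl.
have cc : latdet (d i') (d i) = 0.
  move: Ej gl g0 j0 jl; generalize (latdet (d i') (m i - m i')) (latdet (d i') (d i)) (l i).
  by clear => x y n Ej gl g0 j0 jn; nia.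
by apply: (cycle_parallel_edges cc); move: Ej; rewrite cc mul0r addr0.
Qed.

Lemma cycle_edge_inj i i' j j' : (i < K)%N -> (i' < K)%N ->
  (j < l i)%N -> (j' < l i')%N ->
  m i + d i *+ j = m i' + d i' *+ j' -> i = i'.
Proof.
(* The corner at [m b] makes it the first point of [P] on its edge line, so offsets from [m b] are
   at least those from [m a]. *)
have le a b s t : d a = d b -> m a + d a *+ s = m b + d b *+ t -> (s <= t)%N.
  move=> dd E; have [e c] := cycle_corner_at b.
  have := corner_right c (cycle_mem a); rewrite -lattice_pointB rdet_lattice lerz0.
  have -> : m a - m b = d b *+ t - d b *+ s.
    by rewrite -[in d b *+ s]dd; apply/eqP; rewrite subr_eq addrAC (addrC _ (m b)) -E addrK.
  rewrite latdetBr !latdetMn (latdetC (d b)) (corner_basis c) subr_le0.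
  by rewrite !mulNrn !natz; lia.
move=> iK i'K jl j'l E.
have [j0|j0] := posnP j; have [j'0|j'0] := posnP j'.
- apply: (cycle_inj cycle) => //.
  by move: E; rewrite j0 j'0 !mulr0n !addr0.
- have dd : d i' = d i by apply: cycle_inner_point (esym E); rewrite j'0.
  by have := le _ _ _ _ dd (esym E); lia.
- have dd : d i = d i' by apply: cycle_inner_point E; rewrite j0.
  by have := le _ _ _ _ dd E; lia.
have dd : d i = d i' by apply: cycle_inner_point E; rewrite j0.
have jj : j = j' by apply/eqP; rewrite eqn_leq (le _ _ _ _ dd E) (le _ _ _ _ (esym dd) (esym E)).
by apply: (cycle_inj cycle) => //; move: E; rewrite dd jj => /addIr.
Qed.

(** * Boundary lattice points and widths *)

Hypothesis convexP : forall z z' (t : R), 0 <= t <= 1 -> P z -> P z' ->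
  P (z + t *: (z' - z)).

Lemma cycle_edge_point_mem i j : (j <= l i)%N -> P (lp (m i + d i *+ j)).
Proof.
move=> jl.
have l0 : 0 < (l i)%:R :> R by rewrite ltr0n (cycle_length_gt0 cycle).
have := @convexP _ _ (j%:R / (l i)%:R) _ (cycle_mem i) (cycle_mem i.+1).
rewrite (cycle_step cycle) !lattice_pointD addrAC subrr add0r !lattice_pointMn scalerA.
rewrite mulfVK ?gt_eqF//; apply.
by rewrite divr_ge0//= ler_pdivrMr// mul1r ler_nat.
Qed.

Lemma cycle_edge_point_boundary i j : (j <= l i)%N ->
  boundary P (lp (m i + d i *+ j)).
Proof.
move=> jl; split; first exact/subset_closure/cycle_edge_point_mem.
set z := lp _ => zP.
(* [w] is [d i] turned clockwise by a right angle, an outward normal: any positive step along it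
   leaves [P]. *)
pose w : R * R := ((d i).2%:~R, - (d i).1%:~R).
have wd : rdet (d i) w < 0.
  have -> : rdet (d i) w = (- ((d i).1 ^+ 2 + (d i).2 ^+ 2))%:~R.
    by rewrite /rdet /w /= intrN intrD !rmorphXn /=; ring.
  rewrite ltrz0 oppr_lt0 lt_neqAle addr_ge0 ?sqr_ge0// andbT eq_sym.
  apply/eqP => /eqP; rewrite paddr_eq0 ?sqr_ge0// !sqrf_eq0 => /andP[/eqP d1 /eqP d2].
  by have := cycle_basis i; rewrite /latdet d1 d2 !mul0r subr0.
have cw : z + t *: w @[t --> (0:R)^'+] --> z.
  rewrite -[X in _ --> X]addr0 -(scale0r w); apply: cvg_at_right_filter.
  apply: cvgD; first exact: cvg_cst.
  by apply: cvgZr_tmp; exact: cvg_id.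
have : \forall t \near (0:R)^'+, P (z + t *: w) by exact: cw.
move=> near_P.
have [t [t0 Pt]] : exists t : R, 0 < t /\ P (z + t *: w).
  near (0:R)^'+ => t; exists t; split; near: t => //.
  exact: nbhs_right_gt.
have := cycle_edge_left i Pt.
rewrite addrAC -lattice_pointB addrAC subrr add0r rdetD rdet_lattice latdetMn latdetvv mul0rn add0r.
by rewrite rdetZ leNgt => /negP; apply; rewrite pmulr_rlt0.
Unshelve. all: by end_near.
Qed.

Lemma cycle_length_le n :
  [set x : lattice | boundary P (lp x)] #= `I_n -> (\sum_(i < K) l i <= n)%N.
Proof.
(* Edges are half-open: the end of an edge is counted as the start of the next. *)
pose s := [seq m i + d i *+ j | i <- iota 0 K, j <- iota 0 (l i)].
have -> : (\sum_(i < K) l i)%N = size s.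
  rewrite size_allpairs_dep sumnE big_map -(big_mkord xpredT l) /index_iota subn0.
  by apply: eq_bigr => i _; rewrite size_iota.
apply: uniq_size_card_le.
  apply: allpairs_uniq_dep => [|i _|]; rewrite ?iota_uniq//.
  move=> _ _ /allpairsPdep[a [b [+ + ->]]] /allpairsPdep[a' [b' [+ + ->]]] /=.
  rewrite !mem_iota !add0n /= => aK bl a'K b'l E.
  have aa : a = a' := cycle_edge_inj aK a'K bl b'l E.
  move: E; rewrite -aa => /addrI/(congr1 (latdet (d a.+1))).
  rewrite !latdetMn latdetC cycle_basis !mulNrn !natz => /oppr_inj[->].
  by [].
move=> x /allpairsPdep[i [j [_ + ->]]]; rewrite mem_iota add0n /= => jl.
by apply: cycle_edge_point_boundary; exact: ltnW.
Qed.

(** [- rdet c] extends [latdet _ c] to real points. Comparison with the two adjacent vertices makes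
    it nonnegative on the generators of the cone at [m a.+1], which contains [P]. *)
Lemma cycle_monotone_hull (c : lattice) a z :
  (forall b, latdet (m a.+1) c <= latdet (m b) c) -> P z ->
  (latdet (m a.+1) c)%:~R <= - rdet c z.
Proof.
move=> amin Pz; have corn := cycle_corner cycle a.
have detl x y q : latdet (x + y *+ q) c = latdet x c + latdet y c *+ q.
  by rewrite latdetC latdetDr latdetMn !(latdetC c) opprD mulNrn.
have da1 : 0 <= latdet (d a.+1) c.
  have := amin a.+2; rewrite (cycle_step cycle a.+1) detl lerDl.
  by rewrite pmulrn_lge0// (cycle_length_gt0 cycle).
have da : latdet (d a) c <= 0.
  have := amin a; rewrite (cycle_step cycle a) detl gerDl.
  by rewrite pmulrn_lle0// (cycle_length_gt0 cycle).
have al := corner_left corn Pz; have ar := corner_right corn Pz.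
have := plane_coordE (z - lp (m a.+1)) (corner_basis corn).
move=> /(congr1 (rdet c)); rewrite (rdetB c) (rdetD c) !(rdetZ c) !rdet_lattice latdetNr !(latdetC _ c) !intrN => E.
have : 0 <= (latdet (d a.+1) c)%:~R :> R by rewrite ler0z.
have : (latdet (d a) c)%:~R <= 0 :> R by rewrite lerz0.
move: E al ar.
set A := rdet (d a.+1) _; set B := rdet (- d a) _.
move=> E A0 B0 x0 y0.
nra.
Qed.

(** On the way around the cycle from a minimal to a maximal vertex, the functional grows by at most
    [C] per unit of lattice length. *)
Lemma cycle_width (c : lattice) (C : R) : 0 <= C ->
  (forall i, (latdet (d i) c)%:~R <= C) ->
  exists x0, forall z, P z -> x0 <= - rdet c z <= x0 + C * (\sum_(i < K) l i)%:R.
Proof.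
move=> C0 dC.
have K0 := cycle_pos cycle.
have modK i : m (i %% K)%N = m i.
  rewrite {2}(divn_eq i K) addnC; elim: (i %/ K)%N => [|q IH]; first by rewrite mul0n addn0.
  by rewrite mulSn (addnC K) addnA (cycle_vertexP cycle).
have ext (c' : lattice) : exists a, forall b, latdet (m a.+1) c' <= latdet (m b) c'.
  have [a _ amin] := @Order.TotalTheory.arg_minP _ _ 'I_K (Ordinal K0) xpredT (fun a => latdet (m a) c') isT.
  exists (a + K.-1)%N => b; rewrite -addnS prednK// (cycle_vertexP cycle).
  by have := amin (Ordinal (ltn_pmod b K0)) isT; rewrite /= modK.
have [a amin] := ext c; have [b bmax] := ext (- c).
exists (latdet (m a.+1) c)%:~R => z Pz; rewrite (cycle_monotone_hull amin Pz) /=.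
have := cycle_monotone_hull bmax Pz; rewrite rdetN opprK latdetNr intrN.
set X := rdet c z; set Y := (latdet (m b.+1) c)%:~R => XY.
have step i j : (i <= j)%N -> (latdet (m j) c - latdet (m i) c)%:~R
    <= C * (\sum_(i <= t < j) l t)%:R.
  elim: j => [|j IH] ij.
    by move: ij; rewrite leqn0 => /eqP->; rewrite subrr big_geq// mulr0.
  move: ij; rewrite leq_eqVlt => /orP[/eqP->|ij].
    by rewrite subrr big_geq// mulr0.
  rewrite big_nat_recr//= natrD mulrDr (cycle_step cycle).
  have -> : latdet (m j + d j *+ l j) c - latdet (m i) c =
      latdet (m j) c - latdet (m i) c + latdet (d j) c * (l j)%:Z.
    rewrite latdetC latdetDr latdetMn !(latdetC c) -mulr_natr natz; ring.
  rewrite intrD lerD ?IH// intrM; apply: ler_wpM2r; first by rewrite ler0n.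
  exact: dC.
have : Y - (latdet (m a.+1) c)%:~R <= C * (\sum_(i < K) l i)%:R.
  rewrite /Y -intrB -(modK a.+1) -(modK b.+1).
  set a' := (a.+1 %% K)%N; set b' := (b.+1 %% K)%N.
  have a'K : (a' < K)%N by rewrite ltn_mod.
  have b'K : (b' < K)%N by rewrite ltn_mod.
  rewrite -(big_mkord xpredT l).
  have [ab|ba] := leqP a' b'.
    apply: (le_trans (step _ _ ab)); rewrite ler_wpM2l// ler_nat.
    rewrite (big_cat_nat (leq0n b') (ltnW b'K))/= (big_cat_nat (leq0n a') ab)/=.
    by rewrite -addnA addnCA leq_addr.
  (* Here the maximal vertex comes first, so the path from the minimum passes through
     [m K = m 0]. *)
  have := step _ _ (leq0n b'); have := step _ _ (ltnW a'K).
  have -> : m K = m 0%N by rewrite -(add0n K) (cycle_vertexP cycle).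
  have : C * (\sum_(0 <= t < b') l t + \sum_(a' <= t < K) l t)%:R <= C * (\sum_(0 <= t < K) l t)%:R.
    rewrite ler_wpM2l// ler_nat.
    rewrite (big_cat_nat (leq0n a') (ltnW a'K))/= leq_add2r.
    by rewrite (big_cat_nat (leq0n b') (ltnW ba))/= leq_addr.
  rewrite natrD mulrDr !intrB; lra.
lra.
Qed.

End Cycle.

(** * The golden ratio and the area bound *)

Lemma golden_ratio_ge1 (R : realType) : 1 <= golden_ratio R.
Proof.
rewrite /golden_ratio; have : 1 <= Num.sqrt 5 :> R by rewrite -{1}sqrtr1 ler_sqrt; lra.
lra.
Qed.

Lemma golden_ratio_sqr (R : realType) : golden_ratio R ^+ 2 = golden_ratio R + 1.
Proof.
rewrite /golden_ratio; have : Num.sqrt 5 ^+ 2 = 5 :> R by rewrite sqr_sqrtr; lra.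
set s := Num.sqrt 5; rewrite !expr2 => E.
transitivity ((1 + 2 * s + s * s) / 4); first by field.
by rewrite E; field.
Qed.

Lemma cycle_area_le (R : realType) (P : set (R * R)) (K : nat)
    (m d : nat -> lattice) (l : nat -> nat) : polygon_cycle P K m d l ->
  (normalized_area P <=
    (golden_ratio R ^+ (2 * K) * (\sum_(i < K) l i)%N%:R ^+ 2)%:E)%E.
Proof.
move=> cycle; set phi := golden_ratio R.
have phi1 : 1 <= phi := golden_ratio_ge1 R.
have phi2 : phi ^+ 2 = phi + 1 := golden_ratio_sqr R.
have phi0 : 0 < phi by lra.
have [i good] := exists_good_corner (cycle_fan cycle).
pose C := phi ^+ K / phi.
have C0 : 0 <= C by rewrite divr_ge0 ?exprn_ge0// ltW.
have bound j := @good_corner_bound _ _ (cycle_fan cycle) R phi i j phi1 phi2 good.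
have dC1 j : (latdet (d j) (d i.+1))%:~R <= C.
  by rewrite ler_pdivlMr//; case: (bound j).
have [x0 xb] := cycle_width cycle C0 dC1.
have dC j : (latdet (d j) (- d i))%:~R <= C.
  by rewrite latdetNr -latdetC ler_pdivlMr//; case: (bound j).
have [y0 yb] := cycle_width cycle C0 dC.
set W := C * _ in xb yb.
have W0 : 0 <= W by rewrite mulr_ge0.
rewrite /normalized_area.
(* The two functionals are the coordinates in the basis [d i], [d i.+1], so their matrix has
   determinant 1. *)
have det1 : (d i.+1).2%:~R * - (- d i).1%:~R - (- (d i.+1).1%:~R) * (- d i).2%:~R = 1 :> R.
  have := cycle_basis cycle i.
  move=> /(congr1 (intr : int -> R)); rewrite /latdet /= intrB !intrM rmorph1 => E.
  by rewrite -[RHS]E !intrN; ring.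
have xb' z : P z -> x0 <= (d i.+1).2%:~R * z.1 + - (d i.+1).1%:~R * z.2 <= x0 + W.
  by move=> /xb; rewrite /rdet opprB mulNr.
have yb' z : P z -> y0 <= (- d i).2%:~R * z.1 + - (- d i).1%:~R * z.2 <= y0 + W.
  by move=> /yb; rewrite /rdet opprB mulNr.
have area := area_parallelogram_le det1 W0 xb' yb'.
apply: (le_trans (lee_wpmul2l _ area)); first by rewrite lee_fin.
rewrite -EFinM lee_fin /W exprMn mulrA ler_wpM2r ?sqr_ge0//.
(* The factor 2 of the normalized area is absorbed by [phi ^+ 2 = phi + 1 >= 2]. *)
rewrite mulnC exprM /C expr_div_n phi2 mulrA ler_pdivrMr ?addr_gt0//.
by rewrite mulrC ler_wpM2l ?sqr_ge0//; lra.
Qed.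

Theorem theorem26 (R : realType) (k n : nat) (P : set (R * R)) :
  (0 < k)%N -> (0 < n)%N -> (k <= n)%N ->
  smooth_kgon k n P ->
  (normalized_area P <= (golden_ratio R ^+ (2 * k) * n%:R ^+ 2)%:E)%E.
Proof.
move=> k0 _ _ [[_ [N [p PE]]] smoothP Vk Bn]; subst P.
have [K [m [d [l [Kk cycle]]]]] := exists_polygon_cycle smoothP k0 Vk.
have ln := cycle_length_le cycle (@conv_hull_convex R N _) Bn.
apply: (le_trans (cycle_area_le cycle)); rewrite lee_fin.
have phi1 := golden_ratio_ge1 R.
apply: ler_pM; rewrite ?exprn_ge0 ?ler0n//; first by lra.
  by rewrite ler_weXn2l// leq_mul2l.
by rewrite lerXn2r ?nnegrE ?ler0n// ler_nat.
Qed.
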